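(* Let $A=(a_{ij})$ be an $n\times n$ nonnegative column stochastic matrix. Then: (i) For any subset $V\subset\{1,\dots,n\}$ with $|V|=n-1$, $$\tau_{n-1}(A)=\max_{j=1,\dots,n}\sum_{i\in V}a_{ij}-\sum_{i\in V}\min_{k=1,\dots,n}a_{ik}.$$ (ii) $0\leq\tau_{n-1}(A)\leq 1$. Moreover, $\tau_{n-1}(A)=0$ if and only if $A=x\mathbb{1}^{T}$ for some entrywise nonnegative vector $x$ with $x^{T}\mathbb{1}=1$; and $\tau_{n-1}(A)=1$ if and only if each row of $A$ has at least one zero entry (in other words, $\tau_{n-1}(A)<1$ if and only if $\max_i\min_j a_{ij}>0$).
   Context: $\mathbb{1}$ denotes the all-ones column vector of length $n$. A real square matrix $S$ is nonnegative column stochastic if all its entries are nonnegative and $\mathbb{1}^{T}S=\mathbb{1}^{T}$. For such an $n\times n$ matrix $A=(a_{ij})$, define $\tau_{n-1}(A)=1-\sum_{i=1}^n\min_{j=1,\dots,n}a_{ij}$. *)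

(* Defs.v *)
From HB Require Import structures.
From mathcomp Require Import all_boot all_order all_algebra.
From mathcomp Require Import reals.
Set Implicit Arguments.
Unset Strict Implicit.
Unset Printing Implicit Defensive.
Import Order.TTheory GRing.Theory Num.Theory.
Local Open Scope ring_scope.

(* A nonempty matrix has order n.+1, so the n - 1 of tau_{n-1} is n below. *)

(* The value at ord0 seeds the iterated operation; as ord0 is itself in the
   range, this is the minimum (resp. maximum) of the values of F. *)
Definition min_ord (R : realType) (n : nat) (F : 'I_n.+1 -> R) : R :=
  \big[Num.min/F ord0]_(j < n.+1) F j.

Definition max_ord (R : realType) (n : nat) (F : 'I_n.+1 -> R) : R :=
  \big[Num.max/F ord0]_(j < n.+1) F j.

Definition ones (R : realType) (n : nat) : 'cV[R]_n := const_mx 1.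
Arguments ones {R n}.

Definition column_stochastic (R : realType) (n : nat) (S : 'M[R]_n) : Prop :=
  (forall i j, 0 <= S i j) /\ ones^T *m S = ones^T.

Definition tau (R : realType) (n : nat) (A : 'M[R]_n.+1) : R :=
  1 - \sum_(i < n.+1) min_ord (fun j => A i j).

(* Main.v *)
(* Every column of A sums to 1, so tau A is the sum over i of the nonnegative
   numbers A i j - min_k A i k, whatever the column j: this gives the bounds and
   the case tau A = 0.  For (i), V omits a single index i0, so the sum of the
   column j over V is 1 - A i0 j, whose maximum over j is 1 - min_j A i0 j. *)
Require Import Defs.
From HB Require Import structures.
From mathcomp Require Import all_boot all_order all_algebra.
From mathcomp Require Import reals.
Set Implicit Arguments.
Unset Strict Implicit.
Unset Printing Implicit Defensive.
Import Order.TTheory GRing.Theory Num.Theory.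
Local Open Scope ring_scope.

Lemma min_ord_le (R : realType) (n : nat) (F : 'I_n.+1 -> R) j :
  min_ord F <= F j.
Proof. exact: bigmin_le_cond. Qed.

Lemma le_max_ord (R : realType) (n : nat) (F : 'I_n.+1 -> R) j :
  F j <= max_ord F.
Proof. exact: le_bigmax_cond. Qed.

(** Being a value of [F] holds for the seed [F ord0] and passes to binary minima, because the order
    is total. *)
Lemma min_ord_attained (R : realType) (n : nat) (F : 'I_n.+1 -> R) :
  exists j, min_ord F = F j.
Proof.
apply: (big_ind (fun x => exists j, x = F j)) => [|_ _ [a ->] [b ->]|j _].
- by exists ord0.
- by case: (leP (F a) (F b)) => _; [exists a | exists b].
- by exists j.
Qed.

Lemma max_ord_attained (R : realType) (n : nat) (F : 'I_n.+1 -> R) :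
  exists j, max_ord F = F j.
Proof.
apply: (big_ind (fun x => exists j, x = F j)) => [|_ _ [a ->] [b ->]|j _].
- by exists ord0.
- by case: (leP (F a) (F b)) => _; [exists b | exists a].
- by exists j.
Qed.

(** Each inequality evaluates one extremum at an index attaining it and bounds the other there. *)
Lemma max_ord_subr (R : realType) (n : nat) (c : R) (F : 'I_n.+1 -> R) :
  max_ord (fun j => c - F j) = c - min_ord F.
Proof.
have [a maxE] := max_ord_attained (fun j => c - F j).
have [b minE] := min_ord_attained F.
apply/eqP; rewrite eq_le; apply/andP; split.
  by rewrite maxE lerB ?min_ord_le.
by rewrite minE (le_max_ord (fun j => c - F j)).
Qed.

Lemma max_ord_gt0 (R : realType) (n : nat) (F : 'I_n.+1 -> R) :
  0 < max_ord F <-> exists i, 0 < F i.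
Proof.
split=> [|[i Fi_gt0]]; last exact: lt_le_trans Fi_gt0 (le_max_ord F i).
by have [i ->] := max_ord_attained F; exists i.
Qed.

Lemma min_ord_ge0 (R : realType) (n : nat) (F : 'I_n.+1 -> R) :
  (forall j, 0 <= F j) -> 0 <= min_ord F.
Proof. by move=> F_ge0; have [j ->] := min_ord_attained F. Qed.

Lemma min_ord_eq0 (R : realType) (n : nat) (F : 'I_n.+1 -> R) :
  (forall j, 0 <= F j) -> min_ord F = 0 <-> exists j, F j = 0.
Proof.
move=> F_ge0; split=> [|[j Fj0]].
  by have [j ->] := min_ord_attained F; exists j.
by apply/eqP; rewrite eq_le min_ord_ge0 // andbT -[leRHS]Fj0 min_ord_le.
Qed.

Lemma column_stochastic_sum (R : realType) (n : nat) (S : 'M[R]_n) j :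
  column_stochastic S -> \sum_i S i j = 1.
Proof.
move=> [_ /matrixP/(_ 0 j)]; rewrite !mxE => <-.
by apply: eq_bigr => i _; rewrite !mxE mul1r.
Qed.

Lemma tau_column (R : realType) (n : nat) (A : 'M[R]_n.+1) j :
  column_stochastic A ->
  tau A = \sum_i (A i j - min_ord (fun k => A i k)).
Proof. by move=> hA; rewrite sumrB (column_stochastic_sum j hA). Qed.

Lemma tau_setC1 (R : realType) (n : nat) (A : 'M[R]_n.+1)
    (V : {set 'I_n.+1}) :
  column_stochastic A -> #|V| = n ->
  tau A = max_ord (fun j => \sum_(i in V) A i j)
          - \sum_(i in V) min_ord (fun k => A i k).
Proof.
move=> hA cardV.
have /cards1P[i0 VC] : #|~: V| == 1%N.
  by rewrite -(eqn_add2l #|V|) cardsC card_ord cardV addn1.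
have sumV (F : 'I_n.+1 -> R) : \sum_(i in V) F i = \sum_i F i - F i0.
  rewrite [\sum_i F i](bigD1 i0) //= addrAC subrr add0r.
  by apply: eq_bigl => i; rewrite -[V]setCK VC !inE.
have -> : max_ord (fun j => \sum_(i in V) A i j)
          = max_ord (fun j => 1 - A i0 j).
  have eqF j : \sum_(i in V) A i j = 1 - A i0 j.
    by rewrite sumV column_stochastic_sum.
  (* The rewrite by [eqF] treats the seed, the value at [ord0]; [eq_bigr] treats only the terms. *)
  by rewrite /max_ord eqF; apply: eq_bigr => j _.
(* The minimum of row [i0] cancels, leaving 1 minus the sum of all row minima. *)
by rewrite max_ord_subr sumV opprB addrA subrK.
Qed.

Lemma tau_eq0 (R : realType) (n : nat) (A : 'M[R]_n.+1) :
  column_stochastic A ->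
  tau A = 0 <->
    (exists x : 'cV[R]_n.+1,
       [/\ forall i, 0 <= x i 0, x^T *m ones = 1%:M & A = x *m ones^T]).
Proof.
move=> hA; have [A_ge0 _] := hA; split=> [tau0 | [x [_ _ A_def]]].
  (* Expanding [tau A] along column [j] gives a zero sum of nonnegative terms, so each term
     vanishes; as [j] is arbitrary, every row is constant. *)
  have AE i j : A i j = min_ord (fun k => A i k).
    apply/eqP; rewrite -subr_eq0; apply/eqP.
    (* [erefl true] stands for the trivial index condition, giving the goal the shape of the
       conclusion of [psumr_eq0P]. *)
    move: i (erefl true); apply: psumr_eq0P; last by rewrite -tau_column.
    by move=> i _; rewrite subr_ge0 (min_ord_le (fun k => A i k)).
  (* All columns coincide, so column 0 serves as [x]; its sum is 1 by stochasticity. *)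
  exists (\col_i A i 0); split=> [i||].
  - by rewrite mxE.
  - apply/matrixP => a b; rewrite !ord1 !mxE -(column_stochastic_sum 0 hA).
    by apply: eq_bigr => i _; rewrite !mxE mulr1.
  - by apply/matrixP => i j; rewrite !mxE big_ord1 !mxE mulr1 AE [RHS]AE.
have AE i j : A i j = x i 0 by rewrite A_def mxE big_ord1 !mxE mulr1.
rewrite (tau_column 0 hA) big1 // => i _.
by have [j ->] := min_ord_attained (fun k => A i k); rewrite !AE subrr.
Qed.

Theorem proposition3p1 (R : realType) (n : nat) (A : 'M[R]_n.+1)
    (hA : column_stochastic A) :
  (forall V : {set 'I_n.+1}, #|V| = n ->
     tau A = max_ord (fun j => \sum_(i in V) A i j)
             - \sum_(i in V) min_ord (fun k => A i k))
  /\
  [/\ 0 <= tau A <= 1,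
      tau A = 0 <->
        (exists x : 'cV[R]_n.+1,
           [/\ forall i, 0 <= x i 0, x^T *m ones = 1%:M & A = x *m ones^T]),
      tau A = 1 <-> (forall i, exists j, A i j = 0)
    & tau A < 1 <-> 0 < max_ord (fun i => min_ord (fun j => A i j))].
Proof.
have [A_ge0 _] := hA.
have min_ge0 i : 0 <= min_ord (fun j => A i j) by exact: min_ord_ge0.
have tau_le1 : tau A <= 1 by rewrite gerBl sumr_ge0.
(* [tau A] equals 1 exactly when the row minima sum to 0; being nonnegative, they then all vanish.
   Both characterizations of the extreme value 1 rest on this. *)
have tau1 : tau A = 1 <-> forall i, min_ord (fun j => A i j) = 0.
  split=> [/eqP|min0]; last by rewrite /tau big1 ?subr0.
  rewrite /tau -[eqbRHS]subr0 (inj_eq (addrI 1)) eqr_opp => /eqP sum0 i.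
  exact: (psumr_eq0P _ sum0).
split=> [V|]; first exact: tau_setC1.
split.
- rewrite tau_le1 andbT (tau_column 0 hA) sumr_ge0 // => i _.
  by rewrite subr_ge0 (min_ord_le (fun k => A i k)).
- exact: tau_eq0.
- rewrite tau1; split=> H i; first exact/(min_ord_eq0 (A_ge0 i)).
  exact/(min_ord_eq0 (A_ge0 i)).
(* Given the upper bound, [tau A < 1] means [tau A != 1]. If no row minimum were positive, all would
   be 0 and [tau A] would be 1. *)
- rewrite max_ord_gt0 lt_neqAle tau_le1 andbT; split=> [tau_neq1|[i min_gt0]].
    apply/existsP; apply: contraNT tau_neq1 => /existsPn min_le0.
    apply/eqP/tau1 => i; apply/eqP.
    by rewrite eq_le min_ge0 andbT leNgt min_le0.
  by apply/eqP => /tau1/(_ i) min0; rewrite min0 ltxx in min_gt0.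
Qed.
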